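(* Let $0<\varepsilon<1$ and let $w:\mathbb{R}\to\mathbb{R}$ be a non-decreasing function with $w(x)\ge1$. There exists an absolute constant $c>0$ such that the following is true. Let $2\le d_1\le d_2\le\dots\le d_k$ be integers, and let $L>0$ and $K>0$ be such that (i) $\sum_{i=1}^kw(d_i)/d_i\le K\left(\sum_{i=1}^k\log d_i/\log d_k\right)\cdot(w(d_1)/d_k)$, and (ii) $\sum_{i=1}^kw(d_i)/d_i\ge L\left(\sum_{i=1}^k\log d_i/\log d_k\right)\cdot(w(d_k)/d_k)$. Let $n=\prod_{i=1}^kd_i$, let $\mathbb{F}$ be a field, let $M_i\in\mathbb{F}^{d_i\times d_i}$ be arbitrary and $M=\bigotimes_{i=1}^kM_i$. Then $$R^{rc}_{\mathbb{F}}(M,2d_k\cdot n^{1-\gamma})\le n^{\varepsilon}\quad\text{where}\quad\gamma=\frac{cL\varepsilon^2}{d_k\log d_k\cdot K^2\log^2(K/\varepsilon)}.$$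
   Context: The row-column rigidity $R^{rc}_{\mathbb{F}}(A,r)$ of $A\in\mathbb{F}^{n\times n}$ is the minimal $t$ for which there exists $Z\in\mathbb{F}^{n\times n}$ with $\operatorname{rank}(A-Z)\le r$ and every row and every column of $Z$ having at most $t$ non-zero entries. $\bigotimes$ is the Kronecker product.
   Formalization: One absolute c for all 0<ε<1 is impossible (K=1, all d_i=2, ε→1 makes γ unbounded), so the formal version gives, for each ε_0<1, a c>0 depending only on ε_0 that works for all 0<ε≤ε_0 and all w, d_i, L, K, F, M_i. *)

(* Defs.v *)
From HB Require Import structures.
From mathcomp Require Import all_boot all_order all_algebra.
From mathcomp Require Import mxtens.
From mathcomp Require Import all_classical all_reals all_analysis.

Set Implicit Arguments.
Unset Strict Implicit.
Unset Printing Implicit Defensive.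

Import Order.TTheory GRing.Theory Num.Theory.
Local Open Scope ring_scope.

Section Rigidity.
Variables (F : fieldType) (n : nat).
Implicit Types (A Z : 'M[F]_n) (t : nat).

Definition rc_sparse Z t : bool :=
  [forall i, (#|[pred j | Z i j != 0%R]| <= t)%N] &&
  [forall j, (#|[pred i | Z i j != 0%R]| <= t)%N].

Variable R : realType.
Implicit Type r : R.

(* The target rank r is real-valued, since it is used with r = 2 d n^(1-g). *)
Definition rc_reducible A r t : Prop :=
  exists Z, (\rank (A - Z))%:R <= r /\ rc_sparse Z t.

(* The minimal t exists whenever r >= 0 (lemma rc_rigidityP); for r < 0 there
   is no admissible Z and the value is the default 0. *)
Definition rc_rigidity A r : nat :=
  xget 0%N [set t | rc_reducible A r t /\
                    forall s, rc_reducible A r s -> (t <= s)%N]%classic.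

Lemma rc_rigidityP A r : 0 <= r ->
  rc_reducible A r (rc_rigidity A r) /\
  forall s, rc_reducible A r s -> (rc_rigidity A r <= s)%N.
Proof.
move=> r0.
have exn : exists t, `[< rc_reducible A r t >].
  exists n; apply/asboolP; exists A; rewrite subrr mxrank0; split=> //.
  by apply/andP; split; apply/forallP => i;
    rewrite (leq_trans (max_card _)) // card_ord.
have [t /asboolP rt tmin] := ex_minnP exn.
rewrite /rc_rigidity; case: xgetP => [s _ //|/(_ t)] /= [].
by split=> // s rs; apply: tmin; apply/asboolP.
Qed.

End Rigidity.

(* M_0 (x) (M_1 (x) (... (x) M_(k-1))), the empty product being the 1 x 1
   identity. *)
Fixpoint kronmx (F : fieldType) (k : nat) :
    forall (d : 'I_k -> nat), (forall i, 'M[F]_(d i)) ->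
    'M[F]_(\prod_(i < k) d i)%N :=
  match k return forall (d : 'I_k -> nat), (forall i, 'M[F]_(d i)) ->
    'M[F]_(\prod_(i < k) d i)%N with
  | 0 => fun d _ => 1%:M
  | k'.+1 => fun d M =>
      let e : (d ord0 * \prod_(i < k') d (lift ord0 i))%N =
              (\prod_(i < k'.+1) d i)%N := esym (big_ord_recl _ _) in
      castmx (e, e) (tensmx (M ord0) (kronmx (fun i => M (lift ord0 i))))
  end.

(* Main.v *)
Require Import Defs.
From HB Require Import structures.
From mathcomp Require Import all_boot all_order all_algebra.
From mathcomp Require Import fingroup perm.
From mathcomp Require Import mxtens.
From mathcomp Require Import all_classical all_reals all_analysis.
From mathcomp Require Import ring lra zify.
(* By the PLU decomposition every factor M_i is a permutation matrix times 2 d_k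
   matrices that differ from the identity in a single column (padding with
   identities when d_i < d_k). Kronecker products commute with matrix products,
   and under matrix products the target ranks add up while the sparsities
   multiply, so it suffices to treat a Kronecker product E of matrices E_i that
   differ from the identity only in column J_i.

   Weight an index x, read as a digit vector, by phi(x) = sum of w(d_i) over the
   i with x_i = J_i. Its mean is mu = sum_i w(d_i) / d_i, and a Chernoff bound
   shows that deviations of delta mu have density at most
   exp(- delta^2 mu / (8 w(d_k))). Delete the rows with small phi and the columns
   with large phi. If E(x, y) <> 0 then y arises from x by changing some digits
   to J_i, which raises phi by at least w(d_1) per change; hence the surviving
   entries lie within Hamming distance 2 delta mu / w(d_1) of the diagonal, and
   an exponential moment bounds the size of such a Hamming ball. Hypothesis (i)
   controls this distance and hypothesis (ii) the number of deleted lines. *)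

Import Order.TTheory GRing.Theory Num.Theory.
Local Open Scope ring_scope.

Set Implicit Arguments.
Unset Strict Implicit.
Unset Printing Implicit Defensive.

(** * Digit vectors and entries of Kronecker products *)

(** Dependent case analysis on ['I_k.+1]; the type ['I_(d i)] of a digit varies with its position,
    hence the casts. *)
Definition ord_rect0 k (P : 'I_k.+1 -> Type) (p0 : P ord0)
    (ps : forall i, P (lift ord0 i)) (i : 'I_k.+1) : P i :=
  match unliftP ord0 i with
  | UnliftSome j e => ecast x (P x) (esym e) (ps j)
  | UnliftNone e => ecast x (P x) (esym e) p0
  end.

Lemma ord_rect0_0 k (P : 'I_k.+1 -> Type) (p0 : P ord0) ps :
  ord_rect0 p0 ps ord0 = p0.
Proof.
rewrite /ord_rect0; case: unliftP => [j e|e]; first by have := congr1 val e.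
by rewrite (eq_axiomK e).
Qed.

Lemma ord_rect0_lift k (P : 'I_k.+1 -> Type) (p0 : P ord0) ps i :
  ord_rect0 p0 ps (lift ord0 i) = ps i.
Proof.
rewrite /ord_rect0; case: unliftP => [j e|e]; last by have := congr1 val e.
have ij := lift_inj e; move: e; rewrite -ij => e.
by rewrite (eq_axiomK e).
Qed.

(** The recursion undoes the nesting of [kronmx] step by step, so that entries of [kronmx] become
    products over digits. *)
Fixpoint digit k : forall (d : 'I_k -> nat),
    'I_(\prod_(i < k) d i)%N -> forall i, 'I_(d i) :=
  match k return forall (d : 'I_k -> nat),
    'I_(\prod_(i < k) d i)%N -> forall i, 'I_(d i) with
  | 0 => fun d _ i => False_rect _ (notF (ltn_ord i))
  | k'.+1 => fun d a =>
      let ab := mxtens_unindex (cast_ord (big_ord_recl k' d) a) in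
      ord_rect0 ab.1 (digit ab.2)
  end.

Lemma digit_ord0 k (d : 'I_k.+1 -> nat) (a : 'I_(\prod_(i < k.+1) d i)%N) :
  digit a ord0 = (mxtens_unindex (cast_ord (big_ord_recl k d) a)).1.
Proof. exact: ord_rect0_0. Qed.

Lemma digit_lift k (d : 'I_k.+1 -> nat) (a : 'I_(\prod_(i < k.+1) d i)%N) i :
  digit a (lift ord0 i) =
  digit (mxtens_unindex (cast_ord (big_ord_recl k d) a)).2 i.
Proof. exact: ord_rect0_lift. Qed.

Arguments digit : simpl never.

Lemma digit_inj k (d : 'I_k -> nat) (a b : 'I_(\prod_(i < k) d i)%N) :
  (forall i, digit a i = digit b i) -> a = b.
Proof.
elim: k d a b => [|k IH] d a b ab.
  apply: val_inj => /=; move: (ltn_ord a) (ltn_ord b).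
  by rewrite {2 4}big_ord0 !ltnS !leqn0 => /eqP-> /eqP->.
apply: (@cast_ord_inj _ _ (big_ord_recl k d)).
apply: (can_inj (@mxtens_unindexK _ _)).
rewrite [LHS]surjective_pairing [RHS]surjective_pairing; congr pair.
  by rewrite -!digit_ord0.
by apply: IH => i; rewrite -!digit_lift.
Qed.

Lemma kronmxE (F : fieldType) k (d : 'I_k -> nat)
    (M : forall i, 'M[F]_(d i)) a b :
  kronmx M a b = \prod_(i < k) M i (digit a i) (digit b i).
Proof.
elim: k d M a b => [|k IH] d M a b.
  rewrite [RHS]big_ord0 /= mxE; suff -> : a = b by rewrite eqxx.
  by apply: digit_inj; case.
rewrite [RHS]big_ord_recl [LHS]castmxE /tensmx mxE IH !digit_ord0 !esymK.
by congr (_ * _); apply: eq_bigr => i _; rewrite !digit_lift.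
Qed.

(** Indices correspond bijectively to digit vectors, so this is distributivity. It also expresses
    the independence of the digits in the moment bounds below. *)
Lemma sum_prod_digit (R : comPzSemiRingType) k (d : 'I_k -> nat)
    (g : forall i, 'I_(d i) -> R) :
  \sum_a \prod_i g i (digit a i) = \prod_i \sum_j g i j.
Proof.
elim: k d g => [|k IH] d g.
  rewrite [RHS]big_ord0 (eq_bigr (fun=> 1)) => [|a _]; last by rewrite big_ord0.
  by rewrite sumr_const card_ord {1}big_ord0.
rewrite [RHS]big_ord_recl /= -IH big_distrlr /= pair_bigA /=.
rewrite (reindex (fun p =>
  cast_ord (esym (big_ord_recl k d)) (mxtens_index p))) /=.
  apply: eq_bigr => -[a b] _.
  rewrite [LHS]big_ord_recl digit_ord0 cast_ordKV mxtens_indexK; congr (_ * _).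
  by apply: eq_bigr => i _; rewrite digit_lift cast_ordKV mxtens_indexK.
exists (fun a => mxtens_unindex (cast_ord (big_ord_recl k d) a)) => a _.
  by rewrite cast_ordKV mxtens_indexK.
by rewrite mxtens_unindexK cast_ordK.
Qed.

Lemma kronmx_mul (F : fieldType) k (d : 'I_k -> nat)
    (A B : forall i, 'M[F]_(d i)) :
  kronmx (fun i => A i *m B i) = kronmx A *m kronmx B.
Proof.
apply/matrixP => a b; rewrite kronmxE mxE.
under [RHS]eq_bigr do rewrite !kronmxE -big_split.
rewrite (sum_prod_digit (fun i j => A i (digit a i) j * B i j (digit b i))).
by apply: eq_bigr => i _; rewrite mxE.
Qed.

Lemma eq_kronmx (F : fieldType) k (d : 'I_k -> nat)
    (A B : forall i, 'M[F]_(d i)) :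
  (forall i, A i = B i) -> kronmx A = kronmx B.
Proof.
move=> AB; apply/matrixP => a b; rewrite !kronmxE.
by apply: eq_bigr => i _; rewrite AB.
Qed.

Lemma kronmx1 (F : fieldType) k (d : 'I_k -> nat) :
  kronmx (fun i => 1%:M : 'M[F]_(d i)) = 1%:M.
Proof.
apply/matrixP => a b; rewrite kronmxE mxE.
have [->|ab] := eqVneq a b; first by rewrite big1 // => i _; rewrite mxE eqxx.
have [i dab] : exists i, digit a i != digit b i.
  apply/existsP; rewrite -negb_forall; apply: contra ab => /forallP ab.
  by apply/eqP/digit_inj => i; apply/eqP.
by rewrite (bigD1 i) //= mxE (negPf dab) mul0r.
Qed.

Lemma kronmx_prod (F : fieldType) k (d : 'I_k -> nat) m
    (A : nat -> forall i, 'M[F]_(d i)) :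
  kronmx (fun i => \prod_(j < m) A j i) = \prod_(j < m) kronmx (A j).
Proof.
elim: m => [|m IH].
  by rewrite big_ord0 -[RHS]kronmx1; apply: eq_kronmx => i; rewrite big_ord0.
rewrite big_ord_recr -IH -[RHS]kronmx_mul.
by apply: eq_kronmx => i; rewrite big_ord_recr.
Qed.

Lemma kronmx_neq0 (F : fieldType) k (d : 'I_k -> nat)
    (M : forall i, 'M[F]_(d i)) a b :
  kronmx M a b != 0 -> forall i, M i (digit a i) (digit b i) != 0.
Proof. by rewrite kronmxE => /prodf_neq0 h i; apply: h. Qed.

(** * Sparsity and reducibility of matrix products *)

Lemma rc_sparseP (F : fieldType) n (Z : 'M[F]_n) t :
  reflect ((forall i, (#|[pred j | Z i j != 0%R]| <= t)%N) /\
           (forall j, (#|[pred i | Z i j != 0%R]| <= t)%N)) (rc_sparse Z t).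
Proof.
by apply: (iffP andP) => -[h1 h2]; split; exact/forallP.
Qed.

(** The support of row [i] of [A *m B] lies in the union of the supports of the rows [l] of [B] with
    [A i l != 0]. Columns follow by transposition. *)
Lemma rc_sparse_mul (F : fieldType) n (A B : 'M[F]_n) s t :
  rc_sparse A s -> rc_sparse B t -> rc_sparse (A *m B) (s * t).
Proof.
have row_sparse (C D : 'M[F]_n) p q i :
    (#|[pred j | C i j != 0%R]| <= p)%N ->
    (forall l, #|[pred j | D l j != 0%R]| <= q)%N ->
    (#|[pred j | (C *m D) i j != 0%R]| <= p * q)%N.
  move=> Cp Dq.
  apply: (@leq_trans (\sum_(l | C i l != 0%R) #|[pred j | D l j != 0%R]|)%N).
    apply: (@leq_trans #|\bigcup_(l | C i l != 0) [set j | D l j != 0]|).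
      apply/subset_leq_card/fintype.subsetP => j; rewrite !inE mxE => CDij.
      suff /existsP[l /andP[Cl Dl]] : [exists l, (C i l != 0) && (D l j != 0)].
        by apply/bigcupP; exists l => //; rewrite inE.
      apply: contra_neqT CDij => /existsPn CD; rewrite big1 // => l _.
      by apply/eqP; rewrite mulf_eq0 -[_ || _]negbK negb_or CD.
    elim/big_ind2: _ => [|x1 x2 y1 y2 h1 h2|l _]; first by rewrite cards0.
      by apply: leq_trans (leq_add h1 h2); rewrite cardsU leq_subr.
    by rewrite cardsE.
  apply: (@leq_trans (\sum_(l | C i l != 0%R) q)%N); first exact: leq_sum.
  by rewrite sum_nat_const leq_mul2r Cp orbT.
move=> /rc_sparseP[A1 A2] /rc_sparseP[B1 B2]; apply/rc_sparseP; split=> i.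
  exact: row_sparse.
have -> : #|[pred j | (A *m B) j i != 0]| = #|[pred j | (B^T *m A^T) i j != 0]|.
  by apply: eq_card => j; rewrite !inE -trmx_mul [in RHS]mxE.
have trP (C : 'M[F]_n) l : #|[pred j | C^T l j != 0]| = #|[pred j | C j l != 0]|.
  by apply: eq_card => j; rewrite !inE mxE.
by rewrite mulnC; apply: row_sparse => [|l]; rewrite trP.
Qed.

(** The error telescopes as [(A - Y) *m B + Y *m (B - Z)], and each summand has at most the rank of
    one of the two given errors. *)
Lemma rc_reducible_mul (F : fieldType) n (R : realType) (A B : 'M[F]_n)
    (r1 r2 : R) t1 t2 :
  rc_reducible A r1 t1 -> rc_reducible B r2 t2 ->
  rc_reducible (A *m B) (r1 + r2) (t1 * t2).
Proof.
move=> [Y [rY sY]] [Z [rZ sZ]]; exists (Y *m Z); split; last exact: rc_sparse_mul.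
have -> : A *m B - Y *m Z = (A - Y) *m B + Y *m (B - Z).
  by rewrite mulmxBl mulmxBr addrA subrK.
apply: le_trans (lerD rY rZ); rewrite -natrD ler_nat.
by rewrite (leq_trans (mxrank_add _ _)) // leq_add // (mxrankM_maxl, mxrankM_maxr).
Qed.

Lemma rc_reducible1 (F : fieldType) n (R : realType) :
  rc_reducible (1%:M : 'M[F]_n) (0 : R) 1.
Proof.
exists 1%:M; rewrite subrr mxrank0; split=> //; apply/rc_sparseP.
by split=> i; rewrite -(card1 i); apply: subset_leq_card;
  apply/fintype.subsetP => j; rewrite !inE mxE 1?[i == j]eq_sym;
  case: (j == i); rewrite ?eqxx.
Qed.

Lemma rc_reducible_prod (F : fieldType) n (R : realType) m
    (A : nat -> 'M[F]_n) (r : R) t :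
  (forall j, (j < m)%N -> rc_reducible (A j) r t) ->
  rc_reducible (\prod_(j < m) A j) (m%:R * r) (t ^ m).
Proof.
elim: m => [_|m IH Ared].
  by rewrite big_ord0 mul0r expn0; exact: rc_reducible1.
rewrite big_ord_recr expnSr -natr1 mulrDl mul1r.
apply: rc_reducible_mul; last exact: Ared.
by apply: IH => j jm; apply: Ared; rewrite (ltn_trans jm).
Qed.

(** * Rank bounds from the support *)

Lemma mxrank_row_supp (F : fieldType) m n (A : 'M[F]_(m, n)) (S : pred 'I_m) :
  (forall i j, A i j != 0 -> S i) -> (\rank A <= #|S|)%N.
Proof.
move=> AS; have -> : A = \sum_(i | S i) delta_mx i i *m A.
  apply/row_matrixP => i; apply/rowP => j; rewrite !mxE summxE.
  have [Si|nSi] := boolP (S i).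
    rewrite (bigD1 i) //= big1 ?addr0 => [|l /andP[_ li]].
      by rewrite mxE (bigD1 i) //= big1 ?addr0 ?mxE ?eqxx ?mul1r // => l li;
        rewrite mxE (negPf li) andbF mul0r.
    by rewrite mxE big1 // => p _; rewrite mxE eq_sym (negPf li) mul0r.
  rewrite big1 => [|l Sl].
    by apply/eqP; apply: contraNT nSi => /AS.
  rewrite mxE big1 // => p _; rewrite mxE.
  have -> : (i == l) = false by apply: contraNF nSi => /eqP->.
  by rewrite mul0r.
rewrite -sum1_card; elim/big_ind2: _ => [|x1 x2 y1 y2 h1 h2|l _].
- by rewrite mxrank0.
- by rewrite (leq_trans (mxrank_add _ _)) // leq_add.
- by rewrite (leq_trans (mxrankM_maxl _ _)) // mxrank_delta.
Qed.

(** Once the rows in [S] are split off, the remainder is supported on the columns in [T]. *)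
Lemma mxrank_cross_supp (F : fieldType) m n (A : 'M[F]_(m, n))
    (S : pred 'I_m) (T : pred 'I_n) :
  (forall i j, A i j != 0 -> S i || T j) -> (\rank A <= #|S| + #|T|)%N.
Proof.
move=> AST; pose B := \matrix_(i, j) (if S i then A i j else 0).
have -> : A = B + (A - B) by rewrite addrC subrK.
rewrite (leq_trans (mxrank_add _ _)) // leq_add //.
  by apply: mxrank_row_supp => i j; rewrite mxE; case: (S i); rewrite ?eqxx.
rewrite -mxrank_tr; apply: mxrank_row_supp => j i; rewrite !mxE.
by have := AST i j; case: (S i) => /=; rewrite ?subrr ?eqxx ?subr0.
Qed.

(** * Factorization into one-column matrices *)

(* The columns of A with index in S, completed by columns of the identity. Indices
   are natural numbers, so that an out-of-range singleton gives the identity. *)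
Definition colset (F : fieldType) n (A : 'M[F]_n) (S : pred nat) : 'M[F]_n :=
  \matrix_(a, b) if S b then A a b else (a == b)%:R.

(** The right factor replaces only column [j], by the image of column [j] of [A] under [colset A S].
    That column vanishes on [S], so the left factor fixes it. *)
Lemma colset_mul (F : fieldType) n (A : 'M[F]_n) (S : pred nat) j :
  ~~ S j -> (forall a b : 'I_n, b = j :> nat -> S a -> A a b = 0) ->
  colset A S *m colset A (pred1 j) = colset A [pred b | S b || (b == j)].
Proof.
move=> Sj A0; apply/matrixP => a b; rewrite !mxE /=.
have [bj|bj] := eqVneq (b : nat) j.
  rewrite orbT (bigD1 a) //= !mxE /= bj eqxx.
  rewrite big1 ?addr0 => [|c ca].
    have [Sa|Sa] := boolP (S a); last by rewrite eqxx mul1r.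
    by rewrite (A0 a b) // eqxx mulr0.
  rewrite !mxE /= bj eqxx; have [Sc|Sc] := boolP (S c).
    by rewrite (A0 c b) // mulr0.
  by rewrite eq_sym (negPf ca) mul0r.
rewrite orbF (bigD1 b) //= !mxE /= (negPf bj) eqxx mulr1 big1 ?addr0 // => c cb.
by rewrite !mxE /= (negPf bj) (negPf cb) mulr0.
Qed.

Lemma eq_colset (F : fieldType) n (A : 'M[F]_n) (S T : pred nat) :
  (forall b, (b < n)%N -> S b = T b) -> colset A S = colset A T.
Proof. by move=> ST; apply/matrixP => a b; rewrite !mxE ST. Qed.

Lemma colset0 (F : fieldType) n (A : 'M[F]_n) : colset A xpred0 = 1%:M.
Proof. by apply/matrixP => a b; rewrite !mxE. Qed.

Lemma colsetT (F : fieldType) n (A : 'M[F]_n) : colset A xpredT = A.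
Proof. by apply/matrixP => a b; rewrite !mxE. Qed.

Lemma lower_prod_colset (F : fieldType) n (A : 'M[F]_n) D : (n <= D)%N ->
  (forall a b : 'I_n, (a < b)%N -> A a b = 0) ->
  A = \prod_(j < D) colset A (pred1 (val j)).
Proof.
move=> nD A0; suff H m : \prod_(j < m) colset A (pred1 (val j)) = colset A (gtn m).
  by rewrite H -[LHS]colsetT; apply: eq_colset => b bn /=; rewrite (leq_trans bn).
elim: m => [|m IH]; first by rewrite big_ord0 -[LHS](colset0 A); apply: eq_colset.
rewrite big_ord_recr /= IH -[LHS]/(_ *m _) colset_mul /= ?ltnn //.
  by apply: eq_colset => b _ /=; lia.
by move=> a b bm am; apply: A0; rewrite bm.
Qed.

(** The columns are taken in decreasing order, so that the new column vanishes at all indices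
    treated before; the lower triangular case takes them in increasing order. *)
Lemma upper_prod_colset (F : fieldType) n (A : 'M[F]_n) D : (n <= D)%N ->
  (forall a b : 'I_n, (b < a)%N -> A a b = 0) ->
  A = \prod_(j < D) colset A (pred1 (D - j.+1)%N).
Proof.
move=> nD A0.
suff H m : (m <= D)%N ->
    \prod_(j < m) colset A (pred1 (D - j.+1)%N) = colset A (leq (D - m)).
  by rewrite H // subnn -[LHS]colsetT; apply: eq_colset.
elim: m => [_|m IH mD].
  rewrite big_ord0 subn0 -[LHS](colset0 A); apply: eq_colset => b bn.
  by rewrite leqNgt (leq_trans bn).
rewrite big_ord_recr /= IH 1?ltnW // -[LHS]/(_ *m _) colset_mul /=.
- by apply: eq_colset => b _ /=; lia.
- by rewrite -ltnNge ltn_sub2l.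
- by move=> a b bm am; apply: A0; rewrite bm; lia.
Qed.

(** Each triangular factor of the PLU decomposition contributes [D] one-column matrices. *)
Lemma plu_colset (F : fieldType) n (A : 'M[F]_n) D : (0 < n <= D)%N ->
  exists (s : 'S_n) (E : nat -> 'M[F]_n),
    A = perm_mx s *m \prod_(j < D + D) E j /\
    forall j, exists q : 'I_n, forall a b, E j a b != 0 -> a = b \/ b = q.
Proof.
case: n A => [//|n] A /= nD.
have /is_perm_mxP[s Ps] := cormen_lup_perm A.
have := cormen_lup_correct A.
have := @cormen_lup_lower F n A; have := @cormen_lup_upper F n A; move: Ps.
case: (cormen_lup A) => [[P L] U] /= -> U0 L1 PA.
exists (s^-1)%g.
exists (fun j => if (j < D)%N then colset L (pred1 j)
                 else colset U (pred1 (D - (j - D).+1)%N)).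
split=> [|j].
  rewrite big_split_ord /=.
  under eq_bigr => j _ do rewrite ltn_ord.
  under [X in _ * X]eq_bigr => j _ do rewrite ltnNge leq_addr /= addKn.
  rewrite -(@lower_prod_colset _ _ L) // => [|a b ab]; last first.
    by rewrite L1 1?ltnW // -val_eqE /= ltn_eqF.
  rewrite -upper_prod_colset // -PA -[X in _ *m X]/(perm_mx s *m A) mulmxA.
  by rewrite -perm_mxM mulVg perm_mx1 mul1mx.
have col q B : exists q0 : 'I_n.+1, forall a b : 'I_n.+1,
    colset B (pred1 q) a b != 0 :> F -> a = b \/ b = q0.
  (* For [q] out of range the factor is the identity, and the default value of [inord] is
     harmless. *)
  exists (inord q) => a b; rewrite mxE /=; have [<- _|_] := eqVneq (b : nat) q.
    by right; rewrite inord_val.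
  by have [->|] := eqVneq a b; [left|rewrite eqxx].
by case: ifP => _; apply: col.
Qed.

Lemma rc_reducible_kron_perm (F : fieldType) (R : realType) k (d : 'I_k -> nat)
    (s : forall i, 'S_(d i)) :
  rc_reducible (kronmx (fun i => perm_mx (s i) : 'M[F]_(d i))) (0 : R) 1.
Proof.
set P := kronmx _; exists P; rewrite subrr mxrank0; split=> //.
have Ps a b : P a b != 0 -> forall i, digit b i = s i (digit a i).
  move=> /kronmx_neq0 Pab i; have := Pab i; rewrite !mxE.
  by case: (s i (digit a i) =P _) => [->|]; rewrite ?eqxx.
apply/rc_sparseP; split=> i.
  apply/card_le1_eqP => a b; rewrite !inE => /Ps ia /Ps ib.
  by apply: digit_inj => l; rewrite ia ib.
apply/card_le1_eqP => a b; rewrite !inE => /Ps ia /Ps ib.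
by apply: digit_inj => l; apply: (@perm_inj _ (s l)); rewrite -ia -ib.
Qed.

(** * Exponential moments and tail bounds *)

Lemma card_le_sum (R : numDomainType) (T : finType) (P : pred T) (f : T -> R) :
  (forall x, 0 <= f x) -> (forall x, P x -> 1 <= f x) ->
  (#|P|)%:R <= \sum_x f x.
Proof.
move=> f0 f1; rewrite -sum1_card natr_sum [leRHS](bigID P) /=.
by apply: ler_wpDr; [apply: sumr_ge0|apply: ler_sum].
Qed.

(** From [1 - u <= expR (- u)] and [(1 + u + 2 * u ^+ 2) * (1 - u) = 1 + u ^+ 2 * (1 - 2 * u)]. *)
Lemma expR_le_quadratic (R : realType) (u : R) : u <= 1 / 2 ->
  expR u <= 1 + (u + 2 * u ^+ 2).
Proof.
move=> u2; have u1 : 0 < 1 - u by lra.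
rewrite -(ler_pM2r u1); apply: (@le_trans _ _ 1).
  rewrite -[leRHS](expRxMexpNx_1 u) ler_wpM2l ?expR_ge0 //.
  exact: expR_ge1Dx.
have : 0 <= u ^+ 2 * (1 - 2 * u) by rewrite mulr_ge0 ?sqr_ge0 //; lra.
nra.
Qed.

Lemma sum_expR_digit_le (R : realType) k (d : 'I_k -> nat)
    (J : forall i, 'I_(d i)) (u : 'I_k -> R) :
  (forall i, u i <= 1 / 2) ->
  \sum_a expR (\sum_i u i * (digit a i == J i)%:R) <=
  (\prod_i d i)%N%:R * expR (\sum_i (u i + 2 * u i ^+ 2) / (d i)%:R).
Proof.
move=> u2; under [leLHS]eq_bigr do rewrite expR_sum.
rewrite (sum_prod_digit (fun i j => expR (u i * (j == J i)%:R))).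
rewrite expR_sum natr_prod -big_split /=; apply: ler_prod => i _.
have d0 : (0 : R) < (d i)%:R by rewrite ltr0n (leq_ltn_trans _ (ltn_ord (J i))).
apply/andP; split; first by apply: sumr_ge0 => j _; apply: expR_ge0.
rewrite (bigD1 (J i)) //= eqxx mulr1.
under eq_bigr => j /negPf -> do rewrite mulr0 expR0.
rewrite sumr_const cardC1 card_ord.
apply: (@le_trans _ _ ((d i)%:R * (1 + (u i + 2 * u i ^+ 2) / (d i)%:R)));
  last first.
  by rewrite ler_pM2l // expR_ge1Dx.
rewrite mulrDr mulr1 mulrCA divff ?gt_eqF // mulr1.
have -> : (d i)%:R = 1 + (d i).-1%:R :> R by rewrite nat1r prednK // -(ltr0n R).
by have := expR_le_quadratic (u2 i); lra.
Qed.

(** Markov's inequality for the exponential moment. The [u i] may be negative, so both tails are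
    covered. *)
Lemma digit_tail (R : realType) k (d : 'I_k -> nat)
    (J : forall i, 'I_(d i)) (u : 'I_k -> R) (c : R) :
  (forall i, u i <= 1 / 2) ->
  (#|[pred a | (c <= \sum_i u i * (digit a i == J i)%:R)%R]|)%:R <=
  (\prod_i d i)%N%:R * expR (\sum_i (u i + 2 * u i ^+ 2) / (d i)%:R - c).
Proof.
move=> u2; rewrite expRD mulrA.
apply: le_trans (ler_wpM2r (expR_ge0 _) (sum_expR_digit_le J u2)).
rewrite mulr_suml; apply: card_le_sum => a; first by rewrite mulr_ge0 ?expR_ge0.
by rewrite inE -expRD => ca; rewrite -[leLHS]expR0 ler_expR subr_ge0.
Qed.

(** Each [b] at distance [h] from [a] gets weight [expR (theta * (m - h))], at least 1 in the ball.
    The weights factor over the digits, with factors at most [1 + d i * expR (- theta)]. *)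
Lemma hamming_ball_le (R : realType) k (d : 'I_k -> nat) (theta m : R) a :
  0 <= theta ->
  (#|[pred b | (\sum_(i < k) (digit (d := d) a i != digit b i)%:R <= m)%R]|)%:R <=
  expR (theta * m + \sum_(i < k) (d i)%:R * expR (- theta)).
Proof.
move=> t0.
apply: (@le_trans _ _ (\sum_b expR (theta * m +
    \sum_i (- theta) * (digit a i != digit b i)%:R))).
  apply: card_le_sum => b; first exact: expR_ge0.
  rewrite inE => h; rewrite -[leLHS]expR0 ler_expR -mulr_sumr mulNr subr_ge0.
  exact: ler_wpM2l.
under eq_bigr do rewrite expRD expR_sum.
rewrite -mulr_sumr expRD ler_wpM2l ?expR_ge0 //.
rewrite (sum_prod_digit (fun i j => expR (- theta * (digit a i != j)%:R))) expR_sum.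
apply: ler_prod => i _; apply/andP; split.
  by apply: sumr_ge0 => j _; apply: expR_ge0.
rewrite (bigD1 (digit a i)) //= eqxx mulr0 expR0.
apply: le_trans (expR_ge1Dx _); rewrite lerD2l.
apply: (@le_trans _ _ (\sum_(j | j != digit a i) expR (- theta))).
  by apply: ler_sum => j; rewrite eq_sym => ->; rewrite mulr1.
rewrite sumr_const cardC1 card_ord -[leLHS]mulr_natl ler_wpM2r ?expR_ge0 //.
by rewrite ler_nat leq_pred.
Qed.

(** * Reducibility of Kronecker products *)

(** The bound [hi] limits the variance of the weight, while [lo] turns a weight gap into a number of
    changed digits. *)
Lemma rc_reducible_kron_column (F : fieldType) (R : realType) k (d : 'I_k -> nat)
    (E : forall i, 'M[F]_(d i)) (J : forall i, 'I_(d i)) (w : 'I_k -> R)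
    (lo hi delta theta : R) :
  (forall i a b, E i a b != 0 -> a = b \/ b = J i) ->
  0 < lo -> 0 < hi -> (forall i, lo <= w i <= hi) -> 0 < delta <= 1 -> 0 <= theta ->
  let mu := \sum_i w i / (d i)%:R in
  rc_reducible (kronmx E)
    (2 * ((\prod_i d i)%N%:R * expR (- (delta ^+ 2 * mu / (8 * hi)))))
    (Num.truncn (expR (theta * (2 * delta * mu / lo) +
                       \sum_i (d i)%:R * expR (- theta)))).
Proof.
move=> EJ lo0 hi0 whl /andP[del0 del1] t0 mu.
have w0 i : 0 < w i by have /andP[lw _] := whl i; apply: lt_le_trans lw.
pose phi (a : 'I_(\prod_i d i)%N) : R := \sum_i w i * (digit a i == J i)%:R.
(* This minimizes the Chernoff exponent [2 * s ^+ 2 * hi * mu - s * delta * mu]. *)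
pose s := delta / (4 * hi).
have s0 : 0 < s by rewrite divr_gt0 // mulr_gt0.
have shi : s * hi = delta / 4.
  by rewrite /s; field; rewrite gt_eqF.
have sw i : s * w i <= 1 / 2.
  have /andP[_ wh] := whl i.
  by apply: (@le_trans _ _ (s * hi)); [rewrite ler_pM2l | rewrite shi; lra].
have d0 i : (0 : R) < (d i)%:R by rewrite ltr0n (leq_ltn_trans _ (ltn_ord (J i))).
have second_moment : \sum_i (s * w i) ^+ 2 / (d i)%:R <= s * (delta / 4) * mu.
  rewrite -shi mulr_sumr; apply: ler_sum => i _.
  have -> : (s * w i) ^+ 2 / (d i)%:R = s * (s * w i) * (w i / (d i)%:R).
    by ring.
  rewrite ler_pM2r ?divr_gt0 // !ler_pM2l //.
  by have /andP[] := whl i.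
have key : 2 * (s * (delta / 4) * mu) - s * delta * mu =
    - (delta ^+ 2 * mu / (8 * hi)).
  by rewrite /s; field; rewrite gt_eqF.
pose Rb := [pred a | (phi a <= (1 - delta) * mu)%R].
pose Cb := [pred a | ((1 + delta) * mu <= phi a)%R].
have Rcard : (#|Rb|)%:R <=
    (\prod_i d i)%N%:R * expR (- (delta ^+ 2 * mu / (8 * hi))) :> R.
  have u2 i : - (s * w i) <= 1 / 2 by have := mulr_gt0 s0 (w0 i); lra.
  have := digit_tail J (- (s * ((1 - delta) * mu))) u2.
  rewrite (eq_card (B := Rb)) => [h|a]; last first.
    rewrite !inE; under eq_bigr do rewrite mulNr -mulrA.
    by rewrite sumrN lerN2 -mulr_sumr ler_pM2l.
  apply: (le_trans h); rewrite ler_wpM2l // ler_expR -key.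
  have -> : \sum_i (- (s * w i) + 2 * (- (s * w i)) ^+ 2) / (d i)%:R =
      - (s * mu) + 2 * \sum_i (s * w i) ^+ 2 / (d i)%:R.
    by rewrite !mulr_sumr -sumrN -big_split; apply: eq_bigr => i _ /=; ring.
  by lra.
have Ccard : (#|Cb|)%:R <=
    (\prod_i d i)%N%:R * expR (- (delta ^+ 2 * mu / (8 * hi))) :> R.
  have := digit_tail J (s * ((1 + delta) * mu)) sw.
  rewrite (eq_card (B := Cb)) => [h|a]; last first.
    rewrite !inE; under eq_bigr do rewrite -mulrA.
    by rewrite -mulr_sumr ler_pM2l.
  apply: (le_trans h); rewrite ler_wpM2l // ler_expR -key.
  have -> : \sum_i (s * w i + 2 * (s * w i) ^+ 2) / (d i)%:R =
      s * mu + 2 * \sum_i (s * w i) ^+ 2 / (d i)%:R.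
    by rewrite !mulr_sumr -big_split; apply: eq_bigr => i _ /=; ring.
  by lra.
pose Z := \matrix_(a, b) if (a \in Rb) || (b \in Cb) then 0 else kronmx E a b.
exists Z; split.
  have rk : (\rank (kronmx E - Z)%R <= #|Rb| + #|Cb|)%N.
    apply: mxrank_cross_supp => a b; rewrite !mxE.
    by case: ifP => //; rewrite subrr eqxx.
  apply: (@le_trans _ _ (#|Rb| + #|Cb|)%:R); first by rewrite ler_nat.
  by rewrite natrD mulr_natl mulr2n lerD.
(* A surviving entry has weight gap below [2 * delta * mu], and every digit where [a] and [b] differ
   contributes at least [lo] to the gap. *)
have near a b : Z a b != 0 ->
    \sum_i (digit a i != digit b i)%:R <= 2 * delta * mu / lo.
  rewrite mxE; case: ifP; rewrite ?eqxx // => /norP[].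
  rewrite !inE -!ltNge => aR bC /kronmx_neq0 Eab.
  rewrite ler_pdivlMr // mulrC.
  have h : lo * (\sum_i (digit a i != digit b i)%:R) <= phi b - phi a.
    rewrite mulr_sumr -sumrB; apply: ler_sum => i _; rewrite -mulrBr.
    have := EJ i _ _ (Eab i); have /andP[lw _] := whl i.
    have [->|ab] := eqVneq (digit a i) (digit b i).
      by rewrite mulr0 subrr mulr0.
    case=> [/eqP|bJ]; first by rewrite (negPf ab).
    by rewrite -bJ eqxx (negPf ab) subr0 !mulr1.
  by lra.
apply/rc_sparseP; split=> a; rewrite truncn_ge_nat ?expR_ge0 //;
  apply: le_trans (hamming_ball_le _ a t0); rewrite ler_nat;
  apply/subset_leq_card/fintype.subsetP => b; rewrite !inE => /near //.
by under eq_bigr do rewrite eq_sym.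
Qed.

(** The common bound [D] gives all factorizations the same length, so the Kronecker product of the
    products becomes a product of [D + D] Kronecker products. *)
Lemma rc_reducible_kron (F : fieldType) (R : realType) k (d : 'I_k -> nat)
    (M : forall i, 'M[F]_(d i)) D (w : 'I_k -> R) (lo hi delta theta : R) :
  (forall i, 0 < d i <= D)%N ->
  0 < lo -> 0 < hi -> (forall i, lo <= w i <= hi) -> 0 < delta <= 1 -> 0 <= theta ->
  let mu := \sum_i w i / (d i)%:R in
  rc_reducible (kronmx M)
    ((D + D)%:R *
      (2 * ((\prod_i d i)%N%:R * expR (- (delta ^+ 2 * mu / (8 * hi))))))
    (Num.truncn (expR (theta * (2 * delta * mu / lo) +
                       \sum_i (d i)%:R * expR (- theta))) ^ (D + D)).
Proof.
move=> dD lo0 hi0 whl del t0 mu.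
pose plu i := cid (plu_colset (M i) (dD i)).
pose s i := projT1 (plu i).
pose cE i := cid (projT2 (plu i)).
pose E j i := projT1 (cE i) j.
have MsE i : M i = perm_mx (s i) *m \prod_(j < D + D) E j i.
  by have [] := projT2 (cE i).
have colE j i : exists q : 'I_(d i), forall a b, E j i a b != 0 -> a = b \/ b = q.
  by have [_] := projT2 (cE i); apply.
rewrite (eq_kronmx MsE) kronmx_mul kronmx_prod -[X in rc_reducible _ X]add0r.
rewrite -[(_ ^ _)%N]mul1n; apply: rc_reducible_mul.
  exact: rc_reducible_kron_perm.
apply: (rc_reducible_prod (A := fun j => kronmx (E j))) => j _.
pose J i := projT1 (cid (colE j i)).
apply: (@rc_reducible_kron_column _ _ _ _ _ J) => //.
by move=> i; exact: (projT2 (cid (colE j i))).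
Qed.

Lemma rc_rigidity_le (F : fieldType) n (R : realType) (A : 'M[F]_n) (r r' : R) t :
  0 <= r -> r' <= r -> rc_reducible A r' t -> (rc_rigidity A r <= t)%N.
Proof.
move=> r0 r'r [Z [rZ sZ]]; have [_ min] := rc_rigidityP A r0.
by apply: min; exists Z; split=> //; apply: le_trans r'r.
Qed.

(** * Numerical estimates for the parameters *)

Lemma ln2_ge (R : realType) : 1 / 2 <= ln (2 : R).
Proof.
have -> : (2 : R) = (1 / 2)^-1 by field.
rewrite lnV ?posrE ?divr_gt0 // lerNr.
have -> : (1 / 2 : R) = 1 + - (1 / 2) by field.
apply: (le_trans (le_ln1Dx _)); lra.
Qed.

(* [a] plays the role of [delta * K]: the factor [1 / ln (K / eps)] in [delta]
   absorbs the entropy term [a * ln a^-1]. *)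
Lemma entropy_budget (R : realType) (l0 eps Lam s a : R) :
  s = (36 / l0 + 16)^-1 -> a = s ^+ 2 * eps / Lam ->
  0 < l0 -> 0 < eps < 1 -> l0 <= Lam -> ln eps^-1 <= Lam ->
  a <= 1 /\ 16 * a + 8 * (a * ln a^-1) <= eps.
Proof.
move=> sdef adef l00 /andP[e0 e1] l0L eL.
have L0 : 0 < Lam by apply: lt_le_trans l0L.
have s0 : 0 < s by rewrite sdef invr_gt0 addr_gt0 // divr_gt0.
have sE : s * (36 / l0) + s * 16 = 1.
  by rewrite -mulrDr sdef mulVf // gt_eqF // addr_gt0 // divr_gt0.
have sl0 : 0 < s / l0 by rewrite divr_gt0.
have s1 : s <= 1 by nra.
(* Here [ln x <= x] is applied to [s^-1] and to [Lam]. *)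
have lna : ln a^-1 <= 2 * s^-1 + 2 * Lam.
  have -> : a^-1 = s^-1 ^+ 2 * (eps^-1 * Lam).
    by rewrite adef; field; rewrite !gt_eqF.
  rewrite !lnM ?posrE ?mulr_gt0 ?exprn_gt0 ?invr_gt0 //.
  have : 0 < s^-1 by rewrite invr_gt0.
  move=> /ln_sublinear; have := ln_sublinear L0; lra.
have a0 : 0 < a by rewrite adef divr_gt0 // mulr_gt0 // exprn_gt0.
have sL : s / Lam <= s / l0 by rewrite ler_pM2l // lef_pV2.
have sL0 : 0 < s / Lam by rewrite divr_gt0.
have e36 : s * (36 / l0) = 36 * (s / l0) by rewrite mulrCA.
rewrite e36 in sE.
have h1 : s * (s / Lam) <= s / l0.
  apply: le_trans sL; by rewrite -[leRHS]mul1r ler_pM2r.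
split.
  have -> : a = eps * (s * (s / Lam)) by rewrite adef; ring.
  by have := mulr_gt0 s0 sL0; rewrite -[leRHS]mul1r => X0; apply: ler_pM; lra.
apply: (@le_trans _ _ (16 * a + 8 * (a * (2 * s^-1 + 2 * Lam)))).
  by rewrite lerD2l ler_pM2l // ler_pM2l.
have -> : 16 * a + 8 * (a * (2 * s^-1 + 2 * Lam)) =
    eps * (16 * (s * (s / Lam)) + 16 * (s / Lam) + 16 * (s * s)).
  by rewrite adef; field; rewrite !gt_eqF.
(* The three summands are at most [16 * (s / l0)], [16 * (s / l0)] and [16 * s]; the choice of [s]
   keeps their sum below 1. *)
rewrite -[leRHS]mulr1 ler_pM2l //.
have h2 : s * s <= s by rewrite -[leRHS]mul1r ler_pM2r.
lra.
Qed.

(** With [N] as [ln n] and [S] as the sum of the [d i], this compares logarithms of sparsities. The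
    choice of [theta] makes [expR (- theta)] equal to [a / D ^+ 3], which outweighs the factors
    [D + D] and [S]. *)
Lemma sparsity_budget (R : realType) (N D a eps K mu lo S : R) :
  0 < N -> 2 <= D -> 0 < a <= 1 -> 0 < K -> 0 < lo ->
  S <= 2 * N * D -> mu / lo <= K * (N / (ln D * D)) ->
  16 * a + 8 * (a * ln a^-1) <= eps ->
  let theta := 3 * ln D + ln a^-1 in
  (D + D) * (theta * (2 * (a / K) * mu / lo) + S * expR (- theta)) <= eps * N.
Proof.
move=> N0 D2 /andP[a0 a1] K0 lo0 SN muN aeps; cbv zeta.
set theta := 3 * ln D + ln a^-1.
have D0 : 0 < D by lra.
have l2 : 1 / 2 <= ln D.
  by apply: le_trans (ln2_ge R) _; rewrite ler_ln ?posrE.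
have l0 : 0 < ln D by lra.
have la0 : 0 <= ln a^-1 by rewrite ln_ge0 // invf_ge1.
have th0 : 0 <= theta by rewrite addr_ge0 // mulr_ge0 // ltW.
have eth : expR (- theta) = a / D ^+ 3.
  rewrite expRN /theta expRD expRM_natl !lnK ?posrE ?invr_gt0 //.
  by rewrite invfM invrK mulrC.
have h1 : theta * (2 * (a / K) * mu / lo) <= theta * (2 * a * (N / (ln D * D))).
  apply: ler_wpM2l => //.
  have -> : 2 * (a / K) * mu / lo = 2 * (a / K) * (mu / lo) by rewrite -!mulrA.
  have -> : 2 * a * (N / (ln D * D)) = 2 * (a / K) * (K * (N / (ln D * D))).
    by field; rewrite !gt_eqF.
  by rewrite ler_pM2l // mulr_gt0 // divr_gt0.
have h2 : S * expR (- theta) <= 2 * N * D * (a / D ^+ 3).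
  by rewrite eth ler_wpM2r // divr_ge0 ?exprn_ge0 // ltW.
apply: (@le_trans _ _ ((D + D) *
    (theta * (2 * a * (N / (ln D * D))) + 2 * N * D * (a / D ^+ 3)))).
  by rewrite ler_pM2l ?lerD // addr_gt0.
have -> : (D + D) *
    (theta * (2 * a * (N / (ln D * D))) + 2 * N * D * (a / D ^+ 3)) =
    N * (12 * a + 4 * (a * (ln a^-1 / ln D)) + 4 * (a / D)).
  by rewrite /theta; field; rewrite !gt_eqF.
rewrite mulrC ler_pM2r //; apply: le_trans aeps.
have h3 : a / D <= a / 2 by rewrite ler_pM2l // lef_pV2 ?posrE.
have h4 : a * (ln a^-1 / ln D) <= a * (2 * ln a^-1).
  rewrite ler_pM2l // ler_pdivrMr // mulrAC -[leLHS]mul1r ler_wpM2r //; lra.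
lra.
Qed.

(** Every summand on the left is at least [lo / D], and every logarithm ratio is at most 1. The
    bound on [K] later yields [delta <= 1] and [ln eps^-1 <= ln (K / eps)]. *)
Lemma weight_ratio_ge1 (R : realType) k (d : 'I_k.+1 -> nat) (w : 'I_k.+1 -> R)
    (D K lo : R) :
  1 < D -> 0 < lo ->
  (forall i, lo <= w i) -> (forall i, 1 < ((d i)%:R : R) <= D) ->
  \sum_i w i / (d i)%:R <= K * (\sum_i ln ((d i)%:R : R) / ln D) * (lo / D) ->
  1 <= K.
Proof.
move=> D1 lo0 wlo dD wsum.
have lD0 : 0 < ln D by apply: ln_gt0.
set S := \sum_i ln _ / _ in wsum.
have S0 : 0 < S.
  rewrite /S big_ord_recl ltr_pwDl //.
    by rewrite divr_gt0 // ln_gt0 //; have /andP[] := dD ord0.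
  apply: sumr_ge0 => i _; rewrite divr_ge0 ?ln_ge0 ?ltW //.
  by have /andP[] := dD (lift ord0 i).
have S1 : S <= k.+1%:R.
  rewrite -[X in X%:R]card_ord -sum1_card natr_sum; apply: ler_sum => i _.
  have /andP[di diD] := dD i.
  by rewrite ler_pdivrMr // mul1r ler_ln // posrE; apply: lt_trans ltr01 _.
have c0 : 0 < lo / D by rewrite divr_gt0 // (lt_trans ltr01).
have : k.+1%:R * (lo / D) <= K * S * (lo / D).
  apply: le_trans wsum.
  rewrite -[X in X%:R * _]card_ord -sum1_card natr_sum mulr_suml.
  apply: ler_sum => i _; have /andP[di diD] := dD i; rewrite mul1r.
  by apply: ler_pM; rewrite ?invr_ge0 ?lef_pV2 ?posrE //; lra.
rewrite ler_pM2r // => kK; rewrite -(ler_pM2r S0) mul1r.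
exact: le_trans kK.
Qed.

Lemma ln_prodn (R : realType) k (d : 'I_k -> nat) : (forall i, 0 < d i)%N ->
  ln ((\prod_i d i)%N%:R : R) = \sum_i ln (d i)%:R.
Proof.
elim: k d => [|k IH] d d0; first by rewrite !big_ord0 ln1.
rewrite !big_ord_recl natrM lnM ?posrE ?ltr0n ?d0 //.
  by rewrite IH // => i; apply: d0.
by apply: prodn_gt0.
Qed.

(* The constant c is uniform in eps and w as long as eps stays below a fixed
   eps0 < 1. It cannot be uniform on all of ]0, 1[: gamma is unbounded when
   K = 1 and eps tends to 1. Taking eps0 = eps covers every eps in ]0, 1[. *)
Theorem theorem5p1 (R : realType) (eps0 : R) (eps0_lt1 : eps0 < 1) :
  exists c : R, 0 < c /\
  forall (eps : R) (w : R -> R),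
    0 < eps -> eps <= eps0 ->
    {homo w : x y / x <= y} -> (forall x, 1 <= w x) ->
  forall (k : nat) (d : 'I_k.+1 -> nat) (L K : R),
    (forall i, (2 <= d i)%N) ->
    (forall i j : 'I_k.+1, (i <= j)%N -> (d i <= d j)%N) ->
    0 < L -> 0 < K ->
  let d1 : R := (d ord0)%:R in
  let dk : R := (d ord_max)%:R in
    \sum_(i < k.+1) w (d i)%:R / (d i)%:R
      <= K * (\sum_(i < k.+1) ln ((d i)%:R : R) / ln dk) * (w d1 / dk) ->
    \sum_(i < k.+1) w (d i)%:R / (d i)%:R
      >= L * (\sum_(i < k.+1) ln ((d i)%:R : R) / ln dk) * (w dk / dk) ->
  forall (F : fieldType) (M : forall i : 'I_k.+1, 'M[F]_(d i)),
  let n : R := (\prod_(i < k.+1) d i)%N%:R in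
  let gamma : R :=
    c * L * eps ^+ 2 / (dk * ln dk * K ^+ 2 * ln (K / eps) ^+ 2) in
  (rc_rigidity (kronmx M) (2 * dk * powR n (1 - gamma)))%:R <= powR n eps.
Proof.
have [eps00|eps0_gt0] := leP eps0 0.
  by exists 1; split=> // eps w e0 /(lt_le_trans e0); rewrite ltNge eps00.
pose l0 := ln eps0^-1; pose s := (36 / l0 + 16)^-1.
have l00 : 0 < l0 by rewrite ln_gt0 // invf_gt1.
have s0 : 0 < s by rewrite invr_gt0 addr_gt0 // divr_gt0.
(* With delta = s ^+ 2 * eps / (K * ln (K / eps)) the tail exponent
   delta ^+ 2 * L / (8 * dk * ln dk) is then 4 * gamma. *)
exists (s ^+ 4 / 32); split; first by rewrite divr_gt0 // exprn_gt0.
move=> eps w e0 ee0 wmono w1 k d L K d2 dmono L0 K0 d1 dk wle wge F M.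
pose n : R := (\prod_(i < k.+1) d i)%N%:R.
pose gamma : R :=
  s ^+ 4 / 32 * L * eps ^+ 2 / (dk * ln dk * K ^+ 2 * ln (K / eps) ^+ 2).
suff : (rc_rigidity (kronmx M) (2 * dk * powR n (1 - gamma)))%:R <= powR n eps by [].
pose N := ln n; pose mu := \sum_i w (d i)%:R / (d i)%:R.
pose Lam := ln (K / eps); pose a := s ^+ 2 * eps / Lam.
have dk2 : 2 <= dk by rewrite ler_nat.
have dk0 : 0 < dk by lra.
have dle i : (d i <= d ord_max)%N by apply: dmono; rewrite -ltnS.
have w0 x : 0 < w x by apply: lt_le_trans (w1 x).
have K1 : 1 <= K.
  apply: (@weight_ratio_ge1 _ _ d (fun i => w (d i)%:R) dk K (w d1)) => //.
  - by lra.
  - by move=> i; apply: wmono; rewrite ler_nat dmono.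
  - by move=> i; rewrite ltr1n d2 ler_nat dle.
have e1 : eps < 1 by apply: le_lt_trans eps0_lt1.
have epsL : ln eps^-1 <= Lam.
  by rewrite ler_ln ?posrE ?divr_gt0 ?invr_gt0 // ler_peMl // ltW // invr_gt0.
have l0L : l0 <= Lam.
  by apply: le_trans epsL; rewrite ler_ln ?posrE ?invr_gt0 // lef_pV2 ?posrE.
have L_gt0 : 0 < Lam by apply: lt_le_trans l0L.
have [a1 aeps] := @entropy_budget R l0 eps Lam s a erefl erefl l00
  (introT andP (conj e0 e1)) l0L epsL.
have a0 : 0 < a by rewrite divr_gt0 // mulr_gt0 // exprn_gt0.
have d0 i : (0 < d i)%N by apply: leq_trans (d2 i).
have n0 : 0 < n by rewrite ltr0n prodn_gt0.
have NE : N = \sum_i ln (d i)%:R by apply: ln_prodn.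
have lnd i : 1 / 2 <= ln (d i)%:R :> R.
  by apply: le_trans (ln2_ge R) _; rewrite ler_ln ?posrE ?ltr0n // ler_nat.
have kN : k.+1%:R <= 2 * N.
  rewrite NE mulr_sumr -[X in X%:R]card_ord -sum1_card natr_sum.
  by apply: ler_sum => i _; have := lnd i; lra.
have N0 : 0 < N by have : (0 : R) < k.+1%:R by []; lra.
have ldk0 : 0 < ln dk by rewrite ln_gt0 //; lra.
have sumE : \sum_(i < k.+1) ln ((d i)%:R : R) / ln dk = N / ln dk.
  by rewrite NE mulr_suml.
rewrite sumE -/mu in wle wge.
have powE x : powR n x = expR (x * N) by rewrite /powR gt_eqF.
have nE : expR N = n by rewrite lnK.
have r0 : 0 <= 2 * dk * powR n (1 - gamma).
  by rewrite mulr_ge0 ?powR_ge0 // mulr_ge0 // ltW.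
(* If n ^ gamma <= 2 dk, the allowed rank is at least n. Otherwise n ^ gamma > 2
   absorbs the factor 2 that the two tails lose per column-type factor. *)
have [small|large] := leP (powR n gamma) (2 * dk).
  have -> : rc_rigidity (kronmx M) (2 * dk * powR n (1 - gamma)) = 0%N.
    apply/eqP; rewrite -leqn0; apply: (rc_rigidity_le (r' := n)) => //.
      rewrite powE mulrBl mul1r expRB nE -powE.
      by rewrite mulrA ler_pdivlMr ?powR_gt0 // mulrC ler_pM2r.
    exists 0; rewrite subr0; split; first by rewrite ler_nat rank_leq_row.
    by apply/rc_sparseP; split=> i; rewrite eq_card0 // => j; rewrite !inE mxE eqxx.
  exact: powR_ge0.
pose delta := a / K.
have del0 : 0 < delta by rewrite divr_gt0.
have del1 : delta <= 1 by rewrite ler_pdivrMr // mul1r (le_trans a1).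
pose theta := 3 * ln dk + ln a^-1.
have th0 : 0 <= theta.
  by rewrite addr_ge0 ?ln_ge0 ?invf_ge1 // mulr_ge0 // ltW.
have dD i : (0 < d i <= d ord_max)%N by rewrite d0 dle.
have wb i : w d1 <= w (d i)%:R <= w dk.
  by apply/andP; split; apply: wmono; rewrite ler_nat ?dle ?dmono.
have red := @rc_reducible_kron F R _ d M (d ord_max) (fun i => w (d i)%:R) (w d1)
  (w dk) delta theta dD (w0 _) (w0 _) wb (introT andP (conj del0 del1)) th0.
cbv zeta in red; rewrite -/mu -/n in red.
have rank_le : (d ord_max + d ord_max)%:R *
    (2 * (n * expR (- (delta ^+ 2 * mu / (8 * w dk))))) <=
    2 * dk * powR n (1 - gamma).
  have gammaN : 4 * (gamma * N) <= delta ^+ 2 * mu / (8 * w dk).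
    have -> : 4 * (gamma * N) =
        delta ^+ 2 * (L * (N / ln dk) * (w dk / dk)) / (8 * w dk).
      by rewrite /gamma /delta /a -/Lam; field; rewrite !gt_eqF.
    rewrite ler_pM2r ?invr_gt0 ?mulr_gt0 // ler_pM2l ?exprn_gt0 //.
  rewrite powE in large.
  have gN0 : 0 < gamma * N by rewrite -expR_gt1; lra.
  rewrite natrD -/dk powE mulrBl mul1r expRB nE.
  (* One factor [expR (- (gamma * N))] is the target, a second one cancels the 2. *)
  have expE : 2 * expR (- (delta ^+ 2 * mu / (8 * w dk))) <= (expR (gamma * N))^-1.
    apply: (@le_trans _ _ (2 * expR (- (gamma * N) - gamma * N))).
      by rewrite ler_pM2l // ler_expR; lra.
    rewrite expRD !expRN mulrA ler_piMl ?invr_ge0 ?expR_ge0 //.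
    by rewrite ler_pdivrMr ?expR_gt0 // mul1r; lra.
  have -> : (dk + dk) * (2 * (n * expR (- (delta ^+ 2 * mu / (8 * w dk))))) =
      2 * dk * n * (2 * expR (- (delta ^+ 2 * mu / (8 * w dk)))) by ring.
  by rewrite [leRHS]mulrA ler_pM2l // !mulr_gt0.
apply: (@le_trans _ _ (_ ^ _)%N%:R).
  by rewrite ler_nat; exact: rc_rigidity_le r0 rank_le red.
rewrite natrX powE.
apply: (@le_trans _ _ (expR (theta * (2 * delta * mu / w d1) +
    \sum_i (d i)%:R * expR (- theta)) ^+ (d ord_max + d ord_max))).
  by apply: lerXn2r; rewrite ?nnegrE ?ler0n ?expR_ge0 // truncn_le expR_ge0.
rewrite -expRM_natl ler_expR natrD -/dk -mulr_suml.
apply: sparsity_budget => //.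
- by rewrite a0.
(* The sum of the [d i] is at most [k.+1%:R * dk], and [kN] bounds [k.+1]. *)
- apply: (@le_trans _ _ (\sum_(i < k.+1) dk)).
    by apply: ler_sum => i _; rewrite ler_nat.
  by rewrite sumr_const card_ord -[leLHS]mulr_natl ler_pM2r.
(* This is hypothesis (i) divided by [w d1]. *)
- rewrite ler_pdivrMr //; apply: le_trans wle _.
  by rewrite le_eqVlt; apply/orP; left; apply/eqP; field; rewrite !gt_eqF.
Qed.
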